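(* Let $k$ be a positive integer and let $G$ be an oriented graph without isolated vertices and with minimum pseudo-semidegree $\bar{\delta}^0(G)>5k/8$. Then $G$ contains an alternating path with $k$ vertices.
   Context: An oriented graph is a pair $G=(V,\vec{D})$, where $V$ is a finite set of vertices and $\vec{D}$ is a set of (directed) edges; each edge is an ordered pair of distinct vertices, and for all $u,v$ at most one of $(u,v)$ and $(v,u)$ is an edge. The edge $(u,v)$ is directed from $u$ to $v$. The in-degree of $v$ is $d^-(v)=|\{u\in V:(u,v)\in\vec{D}\}|$ and the out-degree is $d^+(v)=|\{u\in V:(v,u)\in\vec{D}\}|$. A vertex is isolated if $d^-(v)=d^+(v)=0$. For a (nonempty) oriented graph $G$ without isolated vertices, the minimum pseudo-semidegree $\bar{\delta}^0(G)$ is the minimum over all positive values among the in-degrees and out-degrees of the vertices of $G$ (so zero in-degrees and zero out-degrees are ignored). A path in $G$ is a (not necessarily induced) subgraph of $G$ whose underlying undirected graph is a path, so the vertices of a path are distinct. A path is alternating if every vertex of the path is incident, within the path, either only with incoming edges or only with outgoing edges. *)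

(* Defs.v *)
From mathcomp Require Import all_boot all_order all_algebra.

Set Implicit Arguments.
Unset Strict Implicit.
Unset Printing Implicit Defensive.

(* The arc relation [D u v] means that (u,v) is an edge directed from u to v. *)
Definition oriented (V : finType) (D : rel V) : Prop :=
  irreflexive D /\ (forall u v : V, ~~ (D u v && D v u)).

Definition indeg (V : finType) (D : rel V) (v : V) : nat := #|[set u | D u v]|.

Definition outdeg (V : finType) (D : rel V) (v : V) : nat := #|[set u | D v u]|.

Definition isolated (V : finType) (D : rel V) (v : V) : bool :=
  (indeg D v == 0) && (outdeg D v == 0).

Definition degrees (V : finType) (D : rel V) : seq nat :=
  [seq indeg D v | v : V] ++ [seq outdeg D v | v : V].

(* No degree exceeds #|V|, so the default value #|V| does not affect the
   minimum as soon as some degree is positive; see [min_pseudo_semidegreeP]. *)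
Definition min_pseudo_semidegree (V : finType) (D : rel V) : nat :=
  \big[minn/#|V|]_(d <- degrees D | 0 < d) d.

Lemma min_pseudo_semidegreeP (V : finType) (D : rel V) :
  0 < #|V| -> (forall v : V, ~~ isolated D v) ->
  [/\ min_pseudo_semidegree D \in degrees D,
      0 < min_pseudo_semidegree D
    & forall d, d \in degrees D -> 0 < d -> min_pseudo_semidegree D <= d].
Proof.
move=> V0 niso.
have degV d : d \in degrees D -> d <= #|V|.
  by rewrite mem_cat => /orP[] /mapP[v _ ->]; exact: max_card.
have lb d : d \in degrees D -> 0 < d -> min_pseudo_semidegree D <= d.
  rewrite /min_pseudo_semidegree; elim: (degrees D) => // a s IH.
  rewrite inE big_cons => /orP[/eqP<-|ds] d0; first by rewrite d0 geq_minl.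
  by case: ifP => _; rewrite ?geq_min IH ?orbT.
have [d dD d0] : exists2 d, d \in degrees D & 0 < d.
  have /card_gt0P[v _] := V0.
  have := niso v; rewrite negb_and -!lt0n => /orP[] d0; [exists (indeg D v) | exists (outdeg D v)] => //.
    by rewrite mem_cat map_f ?mem_enum.
  by rewrite mem_cat orbC map_f ?mem_enum.
have att : min_pseudo_semidegree D = #|V| \/
    min_pseudo_semidegree D \in degrees D /\ 0 < min_pseudo_semidegree D.
  rewrite /min_pseudo_semidegree; elim: (degrees D) => [|a s IH].
    by left; rewrite big_nil.
  rewrite big_cons inE; case: ifP => a0; last by case: IH => [|[-> ->]]; [left | right; rewrite orbT].
  rewrite /minn; case: ifP => _; first by right; rewrite eqxx a0.
  by case: IH => [|[-> ->]]; [left | right; rewrite orbT].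
case: att => [E|[? ?]]; last by split.
have Ed : min_pseudo_semidegree D = d.
  by apply/eqP; rewrite eqn_leq lb //= E degV.
by split; rewrite // Ed.
Qed.

(* A path is given by the list of its distinct vertices in path order. As D is
   oriented, two adjacent vertices are joined by exactly one arc, so the list
   determines the path as a subgraph. *)
Definition oriented_path (V : finType) (D : rel V) (p : seq V) : bool :=
  uniq p && sorted (fun u v => D u v || D v u) p.

Definition consecutive (V : finType) (p : seq V) (u v : V) : bool :=
  (u, v) \in zip p (behead p).

Definition path_arc (V : finType) (D : rel V) (p : seq V) (u v : V) : bool :=
  D u v && (consecutive p u v || consecutive p v u).

Definition alternating (V : finType) (D : rel V) (p : seq V) : Prop :=
  forall v : V, v \in p ->
    (forall u : V, ~~ path_arc D p v u) \/ (forall u : V, ~~ path_arc D p u v).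

(* Main.v *)
Require Import Defs.
From mathcomp Require Import all_boot all_order all_algebra zify.

(** Call a vertex of an alternating path a source or a sink according to the
    direction of its arcs in the path.  With sources [S] and sinks [T], such a
    path is a path of the bipartite graph [bip D S T] formed by the arcs from
    [S] to [T].  Let every positive in- or out-degree be at least [d].  The
    theorem follows by induction from [has_alt_extend]: if [2 <= m] and
    [5 (m + 1) < 8 d], an alternating path with [m] vertices yields one with
    [m + 1].  Suppose it does not, and let [U] be the vertex set of the given
    path.  Reversing all arcs exchanges sources and sinks, which is used
    throughout as a symmetry.

    Orientation enters mainly through averaging ([exists_low_out]): each
    non-empty [A] inside [S] has a member with at most [|S| - (|A| + 1) / 2]
    out-neighbours in [S].  If the out-neighbourhoods of [A] lie in
    [S :|: T], this member thus has at least [d - |S| + (|A| + 1) / 2]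
    out-neighbours in [T].  Three tools rest on this.
    - Rotation ([rotate_head]): the sources that can be made the first vertex
      of a path on [U], with the other end kept, have all their out-neighbours
      in [U].  So the first vertex can be chosen with many neighbours in [T].
    - Hamiltonicity ([ham_cycle]): a balanced bipartite graph in which both
      sides satisfy such bounds has a Hamiltonian cycle, by the argument of
      Chvatal.  The constant 5/8 is what makes the two sides together suffice.
    - Counting ([closed_absurd]): if [|S| = |T| = r > 0] and [5 r <= 4 d], then
      [S :|: T] cannot contain all out-neighbours of [S] and all in-neighbours
      of those vertices of [S] that receive an arc from [S]; a few exceptional
      in-neighbours can be tolerated when [d] is slightly larger.

    If [m = 2 r], rotating both ends makes their degrees sum to more than [r],
    and the path closes into a cycle through [U] ([bip_close]).  Every source
    of the cycle can now start a path on [U], so all out-neighbours of [S] and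
    all in-neighbours of [T] are in [U].  By counting, some [s'] in [S] has an
    in-neighbour [s] in [S] and an in-neighbour [x'] outside [U].  Then [x']
    has an out-neighbour [y] outside [U], and a Hamiltonian cycle of
    [bip D (S :\ s') (T :\ t0)], cut at [s] and preceded by [y], [x'], [s'],
    has [2 r + 1] vertices ([even_extend]).

    If [m = 2 r + 1], with both ends sources say, the same rotation gives a
    cycle on all of [U] but one source ([bip_close_odd]).  Now let [S] and [T]
    be the two sides of this cycle, [X] the set of vertices outside it with an
    out-neighbour in [T], and [Y] the set of those with an in-neighbour in
    [S]; [X] is not empty.  All out-neighbours of [X] and all in-neighbours of
    [Y] are on the cycle.  If [x] in [X] sends arcs to some [s] in [S] and to
    the successor of [s] on the cycle, no other member of [X] sends an arc to
    [s] ([swap_clash]); there are at least [d - r] such [s] for each [x],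
    whence [|X| <= 3].  If [X] and [Y] both had members [x] and [y], the graph
    [bip D (x |: S) (y |: T)] would have a Hamiltonian cycle with [2 r + 2]
    vertices ([outer_not_both]).  So [Y] is empty, and counting leads to
    [s], [s'] and [x'] as before, with [x'] outside [X] as well; this time a
    Hamiltonian cycle of [bip D (x |: S :\ s') T] is cut at [s] and preceded
    by [x'], [s'] ([outer_absurd]). *)

Set Implicit Arguments.
Unset Strict Implicit.
Unset Printing Implicit Defensive.

(** * Alternating paths as paths of a bipartite graph *)

Section Basics.
Variable V : finType.
Implicit Types (D : rel V) (S T A : {set V}) (p : seq V) (x y u v : V).

Definition conv D : rel V := fun u v => D v u.
Definition out D v : {set V} := [set u | D v u].

(** An arc [D u v] witnesses that [u] has positive out-degree and [v] positive
    in-degree; in this form the bound on the pseudo-semidegree is symmetric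
    under [conv]. *)
Definition mindeg D d :=
  forall u v, D u v -> d <= #|out D u| /\ d <= #|out (conv D) v|.

Definition bip D S T : rel V := fun u v =>
  [&& u \in S, v \in T & D u v] || [&& v \in S, u \in T & D v u].

(** The sets [S] and [T] may be larger than the sets of sources and sinks of
    [p], so that a path can be extended without recomputing them. *)
Definition apath D S T p :=
  [&& [disjoint S & T], uniq p, all (mem (S :|: T)) p & sorted (bip D S T) p].

Definition has_alt D n :=
  [exists S : {set V}, exists T : {set V}, exists p : n.-tuple V, apath D S T p].

Lemma has_altP D n :
  reflect (exists S T p, apath D S T p /\ size p = n) (has_alt D n).
Proof.
apply: (iffP existsP) => [[S /existsP[T /existsP[p h]]]|[S [T [p [h e]]]]].
  by exists S, T, p; rewrite size_tuple.
exists S; apply/existsP; exists T; apply/existsP; exists (tcast e (in_tuple p)).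
by rewrite val_tcast.
Qed.

Lemma apath_has_alt D S T p n : apath D S T p -> size p = n -> has_alt D n.
Proof. by move=> h e; apply/has_altP; exists S, T, p. Qed.

Lemma disjoint_setU1 x S T : [disjoint x |: S & T] = (x \notin T) && [disjoint S & T].
Proof. by rewrite !disjoints_subset subUset sub1set inE. Qed.

Lemma bip_sym D S T : symmetric (bip D S T).
Proof. by move=> u v; rewrite /bip orbC. Qed.

Lemma bip_conv D S T : bip (conv D) T S =2 bip D S T.
Proof. by move=> u v; rewrite /bip /conv orbC; congr (_ || _); rewrite !andbA [_ && (_ \in S)]andbC. Qed.

Lemma apath_conv D S T p : apath (conv D) T S p = apath D S T p.
Proof.
rewrite /apath disjoint_sym setUC; congr [&& _, _, _ & _].
by case: p => //= x p; apply: eq_path; apply: bip_conv.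
Qed.

Lemma has_alt_conv D n : has_alt (conv D) n = has_alt D n.
Proof.
apply/has_altP/has_altP => -[S [T [p [h e]]]]; exists T, S, p; split => //.
  by rewrite -apath_conv.
by rewrite apath_conv.
Qed.

Lemma oriented_conv D : oriented D -> oriented (conv D).
Proof. by case=> h1 h2; split=> // u v; rewrite /conv andbC. Qed.

Lemma mindeg_conv D d : mindeg D d -> mindeg (conv D) d.
Proof. by move=> h u v /h[h1 h2]; split. Qed.

Lemma bip_mono D S T S' T' : S \subset S' -> T \subset T' ->
  subrel (bip D S T) (bip D S' T').
Proof.
move=> /subsetP hS /subsetP hT u v.
by case/orP=> /and3P[a b c]; apply/orP; [left|right]; rewrite hS ?hT.
Qed.

Lemma apath_cons_out D S T x y p : apath D S T (x :: p) -> x \in S ->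
  y \notin S :|: T -> D x y -> apath D S (y |: T) (y :: x :: p).
Proof.
case/and4P=> dis un al so xS yn Dxy; apply/and4P; split.
- rewrite disjoint_sym disjoint_setU1 disjoint_sym dis andbT.
  by move: yn; rewrite inE; case/norP.
- by rewrite cons_uniq un andbT; apply: contra yn => /(allP al).
- apply/allP => z; rewrite inE => /predU1P[->|/(allP al)]; rewrite /= !inE ?eqxx ?orbT //.
  by case/orP=> ->; rewrite ?orbT.
- rewrite /= {1}/bip xS setU11 Dxy orbT /=.
  by apply: sub_path so; apply: bip_mono; rewrite ?subsetUr.
Qed.

Lemma apath_cons_in D S T x y p : apath D S T (x :: p) -> x \in T ->
  y \notin S :|: T -> D y x -> apath D (y |: S) T (y :: x :: p).
Proof.
move=> h xT yn Dyx; rewrite -apath_conv; apply: apath_cons_out => //.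
  by rewrite apath_conv.
by rewrite setUC.
Qed.

Lemma apath_rev D S T p : apath D S T (rev p) = apath D S T p.
Proof.
rewrite /apath rev_uniq all_rev rev_sorted; congr [&& _, _, _ & _].
by case: p => //= x p; apply: eq_path => u v; rewrite bip_sym.
Qed.


Lemma sum_out_conv D A : \sum_(a in A) #|out D a :&: A| = \sum_(a in A) #|out (conv D) a :&: A|.
Proof.
have E (R : rel V) : \sum_(a in A) #|out R a :&: A| = \sum_(a in A) \sum_(b in A) R a b.
  apply: eq_bigr => a _; rewrite -sum1_card [RHS]big_mkcond [LHS]big_mkcond /=.
  by apply: eq_bigr => b _; rewrite !inE; do 2 case: ifP => //=; case: (R a b) => //= ->.
by rewrite !E exchange_big.
Qed.

Lemma out_inI0 D A a : oriented D ->
  out D a :&: A :&: (out (conv D) a :&: A) = set0.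
Proof.
case=> _ or; apply/setP => b; rewrite !inE /conv.
by have := or a b; case: (D a b); case: (D b a); rewrite ?andbF.
Qed.

Lemma out_in_disjoint D A a : oriented D -> a \in A ->
  #|out D a :&: A| + #|out (conv D) a :&: A| < #|A|.
Proof.
move=> orD aA; rewrite -cardsUI.
rewrite (out_inI0 A a orD) cards0 addn0.
rewrite (cardsD1 a A) aA ltnS; apply: subset_leq_card; apply/subsetP => b.
rewrite !inE /conv -andb_orl => /andP[h ->]; rewrite andbT.
by apply: contraTneq h => ->; rewrite (proj1 orD).
Qed.

Lemma out_in_leq D A a : oriented D ->
  #|out D a :&: A| + #|out (conv D) a :&: A| <= #|A|.
Proof.
move=> orD; rewrite -cardsUI.
rewrite (out_inI0 A a orD) cards0 addn0.
by apply: subset_leq_card; rewrite subUset !subsetIr.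
Qed.

(** Inside [A] the out-degrees add up to at most [|A| (|A| - 1) / 2], so some
    member of [A] has fewer than [|A| / 2] out-neighbours in [A]; it has at
    most [|S| - |A|] others in [S]. *)
Lemma exists_low_out D S A : oriented D -> A \subset S -> A != set0 ->
  exists2 a, a \in A & 2 * #|out D a :&: S| + #|A| < 2 * #|S|.
Proof.
move=> orD AS A0.
have [a aA ha] : exists2 a, a \in A & 2 * #|out D a :&: A| < #|A|.
  apply/exists_inP; apply: contraT; rewrite negb_exists_in => /forall_inP h.
  have h1 : \sum_(a in A) #|A| <= \sum_(a in A) 2 * #|out D a :&: A|.
    by apply: leq_sum => a /h; rewrite -leqNgt.
  have h2 : \sum_(a in A) (#|out D a :&: A| + #|out (conv D) a :&: A| + 1)
      <= \sum_(a in A) #|A|.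
    by apply: leq_sum => a aA; rewrite addn1; apply: out_in_disjoint.
  move: h1 h2; rewrite -big_distrr /=.
  rewrite !big_split /= -sum_out_conv sum1_card -card_gt0 in A0 *; lia.
exists a => //.
have : #|out D a :&: S| <= #|out D a :&: A| + #|S :\: A|.
  rewrite -(setID S A) setIUr; apply: leq_trans (leq_card_setU _ _) _.
  apply: leq_add; apply: subset_leq_card; first by rewrite setIS ?subsetIr.
  by rewrite setID subsetIr.
by have := cardsD S A; rewrite (setIidPr AS); have := subset_leq_card AS; lia.
Qed.

End Basics.

(** * Rotating and closing paths of a symmetric relation *)

Section Cycles.
Variable V : eqType.
Implicit Types (e : rel V) (p c : seq V) (x y z u v w : V).

Lemma cycle_at e c x : cycle e c -> uniq c -> x \in c ->
  exists q, [/\ perm_eq (x :: q) c, path e x (rcons q x) & next c =1 next (x :: q)].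
Proof.
move=> cyc un /rot_to[i q E]; exists q; split.
- by rewrite -E perm_rot.
- by move: cyc; rewrite -(rot_cycle i) E.
- by move=> y; rewrite -E next_rot.
Qed.

Lemma next_cat p q u v : uniq (p ++ u :: v :: q) -> next (p ++ u :: v :: q) u = v.
Proof. by move=> un; rewrite -(next_rot (size p)) // rot_size_cat /= eqxx. Qed.

Lemma next_last x p : uniq (x :: p) -> next (x :: p) (last x p) = x.
Proof.
move=> un; rewrite -(next_rotr 1) // lastI rotr1_rcons /=.
by case: p un => [|y p] _ //=; rewrite eqxx.
Qed.

Lemma path_prev e x p y : path e x p -> uniq (x :: p) -> y \in p ->
  e (prev (x :: p) y) y.
Proof.
move=> pth un yp.
have cyc : cycle (fun a b => e a b || (b == x)) (x :: p).
  rewrite /= rcons_path eqxx orbT andbT.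
  by apply: sub_path pth => a b ->.
have yxp : y \in x :: p by rewrite inE yp orbT.
case/orP: (prev_cycle cyc yxp) => // /eqP E.
by move: un; rewrite -E /= yp.
Qed.

Lemma path_next e x p y : path e x p -> uniq (x :: p) -> y \in x :: p ->
  y != last x p -> e y (next (x :: p) y).
Proof.
move=> pth un yp yl.
have cyc : cycle (fun a b => e a b || (b == x)) (x :: p).
  rewrite /= rcons_path eqxx orbT andbT.
  by apply: sub_path pth => a b ->.
case/orP: (next_cycle cyc yp) => // /eqP E.
by case/eqP: yl; apply: (can_inj (prev_next un)); rewrite E next_last.
Qed.

Lemma path_rev_tail e x v q : symmetric e ->
  path e x (rev (v :: q)) = e x (last v q) && path e v q.
Proof.
move=> sym; rewrite lastI rev_rcons /= rev_path; congr (_ && _).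
by apply: eq_path => a b; rewrite sym.
Qed.

Lemma path_split_next x p u : uniq (x :: p) -> u \in x :: p -> u != last x p ->
  exists p1 p2, x :: p = p1 ++ u :: next (x :: p) u :: p2.
Proof.
move=> un uin ul.
have [p1 [p2 E]] : exists p1 p2, x :: p = p1 ++ u :: p2.
  by case/splitPr: uin => p1 p2; exists p1, p2.
case: p2 E => [|v p2] E; last by exists p1, p2; rewrite E next_cat // -E.
by case/eqP: ul; rewrite -[last x p]/(last x (x :: p)) E last_cat.
Qed.

(** The Posa rotation: reverse the segment of [x :: p] from [x] to [u] and
    join it, through [x], to the vertex that followed [u]. *)
Lemma path_rotate e x p u : symmetric e -> path e x p -> uniq (x :: p) ->
  u \in x :: p -> u != last x p -> e x (next (x :: p) u) ->
  exists q, [/\ path e u q, perm_eq (u :: q) (x :: p) & last u q = last x p].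
Proof.
move=> sym pth un uin ul; have [p1 [p2 E]] := path_split_next un uin ul.
set v := next _ _ in E *; move=> exv.
case: p1 E => [|y p1] /= [Ex Ep]; first by exists p; rewrite -Ex.
exists (rev (x :: p1) ++ v :: p2); rewrite Ep; split.
- move: pth; rewrite Ep cat_path /= => /and4P[h1 h2 h3 h4].
  rewrite cat_path path_rev_tail // sym h2 h1 /= h4 andbT.
  by rewrite rev_cons last_rcons.
- by apply/permP => P; rewrite /= !count_cat count_rev /=; lia.
- by rewrite !last_cat.
Qed.

(** Rotating at [u] makes [u] and [last x p], which are adjacent, the two
    ends. *)
Lemma path_close e x p u : symmetric e -> path e x p -> uniq (x :: p) ->
  u \in x :: p -> u != last x p -> e u (last x p) -> e x (next (x :: p) u) ->
  exists2 c, perm_eq c (x :: p) & cycle e c.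
Proof.
move=> sym pth un uin ul euz exv.
have [q [pq pe lq]] := path_rotate sym pth un uin ul exv.
by exists (u :: q) => //; rewrite /= rcons_path pq lq sym.
Qed.

(** The variant for two ends on the same side of a bipartite graph, which
    cannot be adjacent: the cycle bypasses [u] through its two neighbours in
    the path. *)
Lemma path_close_skip e x p u : symmetric e -> path e x p -> uniq (x :: p) ->
  u \in x :: p -> u != last x p -> u != x ->
  e (last x p) (prev (x :: p) u) -> e x (next (x :: p) u) ->
  exists2 c, perm_eq (u :: c) (x :: p) & cycle e c.
Proof.
move=> sym pth un uin ul ux; have [p1 [p2 E]] := path_split_next un uin ul.
have /negP := ux; set v := next _ _ in E *.
case: p1 E => [|y p1] /= [Ex Ep]; first by rewrite Ex eqxx.
move=> _ ezw exv; exists ((x :: p1) ++ rev (v :: p2)).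
  by apply/permP => P; rewrite Ep /= !count_cat count_rev /=; lia.
move: pth; rewrite Ep cat_path /= => /and4P[h1 h2 h3 h4].
rewrite rcons_path last_cat cat_path h1 path_rev_tail // h4 rev_cons last_rcons (sym v x) exv !andbT /=.
suff <- : prev (x :: p) u = last x p1 by move: ezw; rewrite Ep last_cat /= sym.
apply: (can_inj (prev_next un)); rewrite next_prev // Ep.
move: un; rewrite Ep; case/lastP: {h1 h2 Ep}p1 => [|p1 w].
  by move=> un; rewrite /= eqxx.
by rewrite last_rcons -cats1 -catA -cat_cons => un; rewrite next_cat.
Qed.

End Cycles.

(** * Rotation and Hamiltonian cycles in bipartite graphs *)

Section Ham.
Variable V : finType.
Implicit Types (D : rel V) (S T A : {set V}) (p q c : seq V) (x y z s t u v : V).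

Lemma bip_l D S T u v : [disjoint S & T] -> u \in S -> bip D S T u v = (v \in T) && D u v.
Proof. by move=> dis uS; rewrite /bip uS (disjointFr dis uS) /= andbF orbF. Qed.

Lemma bip_r D S T u v : [disjoint S & T] -> u \in T -> bip D S T u v = (v \in S) && D v u.
Proof. by move=> dis uT; rewrite /bip uT (disjointFl dis uT). Qed.

Lemma bip_lr D S T u v : bip D S T u v -> (u \in S) && (v \in T) || (u \in T) && (v \in S).
Proof. by case/orP=> /and3P[-> -> _]; rewrite ?orbT. Qed.

(** Here [S] and [T] are exactly the sets of sources and sinks of the path: it
    is a Hamiltonian path of [bip D S T]. *)
Definition spath D S T p : Prop :=
  [/\ uniq p, sorted (bip D S T) p & p =i S :|: T].
Definition scycle D S T c : Prop :=
  [/\ uniq c, cycle (bip D S T) c & c =i S :|: T].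

Lemma card_prev (x : V) p (A : {set V}) :
  uniq (x :: p) -> #|[set prev (x :: p) t | t in A]| = #|A|.
Proof. by move=> un; apply: card_imset; apply: can_inj (next_prev un). Qed.

Lemma card_next (x : V) p (A : {set V}) :
  uniq (x :: p) -> #|[set next (x :: p) t | t in A]| = #|A|.
Proof. by move=> un; apply: card_imset; apply: can_inj (prev_next un). Qed.

Lemma card_meet S A (B : {set V}) : A \subset S -> B \subset S -> #|S| < #|A| + #|B| ->
  exists2 u, u \in A & u \in B.
Proof.
move=> AS BS lt; have : #|A :|: B| <= #|S| by rewrite subset_leq_card // subUset AS.
have := cardsUI A B => E ltU.
have /card_gt0P[u] : 0 < #|A :&: B| by lia.
by rewrite inE => /andP[]; exists u.
Qed.

Lemma prev_in_source D S T x p t : [disjoint S & T] -> spath D S T (x :: p) -> x \in S ->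
  t \in T -> prev (x :: p) t \in S.
Proof.
move=> dis [un so eqp] xS tT.
have tp : t \in p.
  have : t \in x :: p by rewrite eqp inE tT orbT.
  by rewrite inE => /predU1P[E|//]; rewrite E (disjointFr dis xS) in tT.
have := bip_lr (path_prev so un tp); rewrite tT orbC (disjointFl dis tT).
by rewrite andbF /= andbT.
Qed.

(** The predecessors of the neighbours of [x], and the neighbours of [last x
    p], are all in [S]; by cardinality some [u] is of both kinds, which is
    what [path_close] requires. *)
Lemma bip_close D S T x p : [disjoint S & T] -> spath D S T (x :: p) ->
  x \in S -> last x p \in T ->
  #|S| < #|out D x :&: T| + #|out (conv D) (last x p) :&: S| ->
  exists c, scycle D S T c.
Proof.
move=> dis sp xS zT; have [un so eqp] := sp.
rewrite -(card_prev (out D x :&: T) un) => lt; have [||u] := card_meet _ _ lt.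
- by apply/subsetP=> _ /imsetP[t /setIP[_ tT] ->]; apply: (prev_in_source dis sp xS tT).
- exact: subsetIr.
move=> /imsetP[t /setIP[xt tT] Eu] /setIP[zu uS].
have [||||c pc cyc] := path_close (u := u) (@bip_sym _ D S T) so un.
- by rewrite eqp inE uS.
- by apply: contraTneq uS => ->; rewrite (disjointFl dis).
- by rewrite bip_l // zT; rewrite inE in zu.
- by rewrite Eu next_prev // bip_l // tT; rewrite inE in xt.
by exists c; split=> //; [rewrite (perm_uniq pc)|move=> y; rewrite (perm_mem pc)].
Qed.

(** As [bip_close], with the predecessors of the neighbours of one end and the
    successors of those of the other. *)
Lemma bip_close_odd D S T x p : [disjoint S & T] -> spath D S T (x :: p) ->
  x \in S -> last x p \in S ->
  #|S| < #|out D x :&: T| + #|out D (last x p) :&: T| ->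
  exists u c, [/\ u \in S, exists2 t, t \in T & D u t & scycle D (S :\ u) T c].
Proof.
move=> dis sp xS zS; have [un so eqp] := sp.
rewrite -(card_prev (out D x :&: T) un) -(card_next (out D (last x p) :&: T) un) => lt; have [||u] := card_meet _ _ lt.
- by apply/subsetP=> _ /imsetP[t /setIP[_ tT] ->]; apply: (prev_in_source dis sp xS tT).
- apply/subsetP=> _ /imsetP[t /setIP[_ tT] ->].
  have tz : t != last x p by apply: contraTneq tT => ->; rewrite (disjointFr dis).
  have tin : t \in x :: p by rewrite eqp inE tT orbT.
  have := bip_lr (path_next so un tin tz); rewrite tT (disjointFl dis tT) /=.
  by [].
move=> /imsetP[t1 /setIP[xt t1T] E1] /imsetP[t2 /setIP[zt t2T] E2].
have nu : next (x :: p) u = t1 by rewrite E1 next_prev.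
have pu : prev (x :: p) u = t2 by rewrite E2 prev_next.
have uS : u \in S by rewrite E1; apply: (prev_in_source dis sp xS t1T).
have uin : u \in x :: p by rewrite eqp inE uS.
have ul : u != last x p.
  by apply: contraTneq t1T => E; rewrite -nu E next_last // (disjointFr dis).
have ux : u != x.
  apply: contraTneq t2T => E; rewrite -pu E -{2}(next_last un) prev_next //.
  by rewrite (disjointFr dis).
rewrite !inE in xt zt.
have [||c pc cyc] := path_close_skip (@bip_sym _ D S T) so un uin ul ux.
- by rewrite pu bip_l // t2T.
- by rewrite nu bip_l // t1T.
exists u, c.
have uuc : uniq (u :: c) by rewrite (perm_uniq pc).
have mc y : y \in c -> y != u.
  by move=> yc; apply: contraTneq yc => ->; case/andP: uuc.
split=> //.
  exists t1 => //; have := path_next so un uin ul; rewrite nu bip_l //.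
  by case/andP.
split; first by case/andP: uuc.
  apply: (sub_in_cycle (P := predC1 u)) cyc; last exact/allP.
  by move=> a b /= au bu; rewrite /bip !inE (negPf au) (negPf bu).
move=> y; have := perm_mem pc y; rewrite eqp !inE.
case: (y =P u) => [-> _|_ /= -> //]; rewrite (disjointFr dis uS).
by apply/negbTE; case/andP: uuc.
Qed.

(** If the head [x] has [e < k] neighbours in [T], rotations turn the [e]
    predecessors of these into heads, and one of them has at least [(e + k) /
    2 > e] neighbours.  Iterating, the degree of the head reaches [k]. *)
Lemma rotate_head D S T z k : [disjoint S & T] ->
  (forall A, A \subset S -> A != set0 ->
    (forall a, a \in A -> exists p, spath D S T (a :: p) /\ last a p = z) ->
    exists2 a, a \in A & #|A| + k <= 2 * #|out D a :&: T|) ->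
  forall x p, x \in S -> p != [::] -> spath D S T (x :: p) -> last x p = z ->
  exists y q, [/\ y \in S, spath D S T (y :: q), last y q = z
                & k <= #|out D y :&: T|].
Proof.
move=> dis hA x p; have [m] := ubnP (#|T| - #|out D x :&: T|).
elim: m x p => // m IH x p lem xS p0 sp lz; have [un so eqp] := sp.
case: (leqP k #|out D x :&: T|) => [kx|xk]; first by exists x, p.
set A := [set prev (x :: p) t | t in out D x :&: T].
have heads a : a \in A -> [/\ a \in S & exists q, [/\ spath D S T (a :: q), last a q = z & q != [::]]].
  case/imsetP=> t /setIP[xt tT] Ea.
  have na : next (x :: p) a = t by rewrite Ea next_prev.
  have aS : a \in S by rewrite Ea; apply: (prev_in_source dis sp xS tT).
  have [|||q [pq pe lq]] := path_rotate (u := a) (@bip_sym _ D S T) so un.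
  - by rewrite eqp inE aS.
  - by apply: contraTneq tT => E; rewrite -na E next_last // (disjointFr dis).
  - by rewrite na bip_l // tT; rewrite inE in xt.
  split=> //; exists q; split; last 2 first; [by rewrite lq| |].
    have /= [/esym/eqP] := perm_size pe; apply: contraTN => /eqP->.
    by rewrite size_eq0.
  by split=> //; [rewrite (perm_uniq pe)|move=> y; rewrite (perm_mem pe)].
have [|||a aA ha] := hA A.
- by apply/subsetP=> a /heads[].
- case: p p0 so {IH sp lz un eqp heads} @A => // y p _ /= /andP[xy _].
  rewrite bip_l // in xy; case/andP: xy => yT Dxy.
  by apply/set0Pn; eexists; apply/imsetP; exists y; rewrite ?inE ?yT ?Dxy.
- by move=> a /heads[_ [q []]]; exists q.
have [aS [q [sq lq q0]]] := heads a aA.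
rewrite (card_prev _ un) in ha.
have := subset_leq_card (subsetIr (out D a) T) => ?.
by apply: (IH a q) => //; lia.
Qed.

(** Base case of [ham_cycle]: alternate between an enumeration of [S] and one
    of [T]. *)
Lemma complete_cycle D S T : [disjoint S & T] -> #|S| = #|T| -> 0 < #|S| ->
  (forall s t, s \in S -> t \in T -> D s t) -> exists c, scycle D S T c.
Proof.
move=> dis eST S0 hD.
have inter t0 ss ts : size ss = size ts -> {subset ss <= S} -> {subset ts <= T} ->
    t0 \in T -> exists q, [/\ path (bip D S T) t0 q, perm_eq q (ss ++ ts) & last t0 q \in T].
  elim: ss ts t0 => [|s ss IH] [|t ts] t0 //= => [_ _ _|[es] hs ht] t0T; first by exists [::].
  have [|||q [pq pe lq]] := IH ts t es.
  - by move=> y yss; apply: hs; rewrite inE yss orbT.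
  - by move=> y yss; apply: ht; rewrite inE yss orbT.
  - by apply: ht; rewrite inE eqxx.
  have sS : s \in S by apply: hs; rewrite inE eqxx.
  have tT : t \in T by apply: ht; rewrite inE eqxx.
  exists (s :: t :: q); split=> //=.
    by rewrite bip_r // bip_l // sS tT !hD.
  by apply/permP=> P; have /permP/(_ P) := pe; rewrite /= !count_cat /=; lia.
have /card_gt0P[t0 t0T] : 0 < #|T| by rewrite -eST.
have [|||| q [pq pe lq]] := inter t0 (enum S) (enum T).
- by rewrite -!cardE.
- by move=> y; rewrite mem_enum.
- by move=> y; rewrite mem_enum.
- by [].
have mq : q =i S :|: T.
  by move=> y; rewrite (perm_mem pe) mem_cat !mem_enum inE.
exists q; split=> //.
  rewrite (perm_uniq pe) cat_uniq !enum_uniq andbT /=.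
  apply/hasPn => y; rewrite !mem_enum => yT; by rewrite (disjointFl dis yT).
case: q pq lq mq {pe} => //= s q /andP[ts pq] lq _.
rewrite rcons_path pq bip_r // hD //=.
  by move: ts; rewrite bip_r // => /andP[->].
by move: ts; rewrite bip_r // => /andP[->].
Qed.

(** A cycle either avoids an added arc or becomes, when cut there, a path
    joining the ends of this arc. *)
Lemma scycle_del_arc D S T s t c : [disjoint S & T] -> s \in S -> t \in T ->
  2 < size c -> scycle (fun u v => D u v || (u == s) && (v == t)) S T c ->
  (exists c', scycle D S T c') \/
  (exists p, spath D S T (s :: p) /\ last s p = t).
Proof.
set D' := fun u v => _; move=> dis sS tT sz [un cyc eqc].
have sc : s \in c by rewrite eqc inE sS.
have [q [pe pq _]] := cycle_at cyc un sc.
have uq : uniq (s :: q) by rewrite (perm_uniq pe).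
have eqq : s :: q =i S :|: T by move=> y; rewrite (perm_mem pe).
have sq : 1 < size q by have := perm_size pe; move: sz => /= ? ?; lia.
have bipE a b : (a == s) && (b == t) = false -> (b == s) && (a == t) = false ->
    bip D' S T a b -> bip D S T a b.
  by rewrite /bip /D' => -> ->; rewrite !orbF.
have nst : s == t = false by apply/eqP=> E; rewrite -E (disjointFr dis sS) in tT.
case: q pe pq uq eqq sq => // h q pe /=; rewrite rcons_path => /and3P[sh hq lqs].
move=> uq eqq sq.
have {}hq : path (bip D S T) h q.
  apply: (sub_in_path (P := predC1 s)) hq => [a b /negPf as_ /negPf bs|].
    by apply: bipE; rewrite ?as_ ?bs.
  apply/allP=> y yq /=; apply: contraTneq yq => ->; by case/andP: uq.
have hl : h != last h q.
  case: q sq uq {pe eqq hq lqs} => //= y q _ /and4P[_ hn _ _].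
  by apply: contraNneq hn => ->; rewrite mem_last.
case: (h =P t) => [ht|/eqP/negPf ht].
  right; have lt : (last h q == t) = false by rewrite -ht eq_sym; apply/negbTE.
  have ls : (last h q == s) = false.
    by apply/negbTE; case/andP: uq => un1 _; apply: contraNneq un1 => <-; apply: mem_last.
  exists (rev (h :: q)); rewrite rev_cons last_rcons; split => //; split.
  - rewrite -rev_cons /= mem_rev rev_uniq; exact: uq.
  - rewrite -rev_cons /= path_rev_tail ?hq ?andbT; last exact: bip_sym.
    by rewrite bip_sym; apply: bipE lqs; rewrite ?lt ?ls ?andbF.
  - by move=> y; rewrite -rev_cons -eqq !(inE, mem_rev).
have hs : (h == s) = false.
  by apply/negbTE; case/andP: uq => un1 _; apply: contraNneq un1 => <-; rewrite inE eqxx.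
have {}sh : bip D S T s h by apply: bipE sh; rewrite ?ht ?hs ?andbF.
case: (last h q =P t) => [lt|/eqP/negPf lt].
  by right; exists (h :: q); split=> //; split=> //=; rewrite sh.
left; exists (s :: h :: q); split=> //=; rewrite sh rcons_path hq /=.
by apply: bipE lqs; rewrite ?nst ?lt ?andbF.
Qed.

(** Add missing arcs one at a time: if the graph with the arc [(s, t)] added
    is Hamiltonian but [D] is not, then [s] and [t] are joined by a
    Hamiltonian path, and [bip_close] bounds the sum of their degrees [e] and
    [f] by [r = |S|].  Take [(s, t)] with [e + f] largest among the missing
    arcs.  Then the [r - f] sources not adjacent to [t] have degree at most
    [e], whence [r - f + kS <= 2 e], and likewise [r - e + kT <= 2 f].  Adding
    up, [2 r + kS + kT <= 3 (e + f) <= 3 r], contrary to the assumption. *)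
Theorem ham_cycle D S T kS kT : [disjoint S & T] -> #|S| = #|T| -> 0 < #|S| ->
  (forall A, A \subset S -> A != set0 ->
    exists2 a, a \in A & #|A| + kS <= 2 * #|out D a :&: T|) ->
  (forall A, A \subset T -> A != set0 ->
    exists2 a, a \in A & #|A| + kT <= 2 * #|out (conv D) a :&: S|) ->
  #|S| < kS + kT -> exists c, scycle D S T c.
Proof.
move=> dis eST S0 + + ltk.
have [m] := ubnP #|[set st | (st.1 \in S) && (st.2 \in T) && ~~ D st.1 st.2]|.
elim: m D => // m IH D; set N := [set st | _] => ltN hS hT.
case: (set_0Vmem N) => [N0|[st0 st0N]].
  apply: complete_cycle => // s t sS tT; apply: contraT => nD.
  by have := in_set0 (s, t); rewrite -N0 !inE sS tT nD.
pose f (st : V * V) := #|out D st.1 :&: T| + #|out (conv D) st.2 :&: S|.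
case: (@arg_maxnP _ st0 (fun st => st \in N) f st0N) => -[s t]; rewrite inE /= => /andP[/andP[sS tT] nst] mx.
pose D' : rel V := fun u v => D u v || (u == s) && (v == t).
have sub u : out D u \subset out D' u by apply/subsetP=> v; rewrite !inE /D' => ->.
have sub2 u : out (conv D) u \subset out (conv D') u.
  by apply/subsetP=> v; rewrite !inE /conv /D' => ->.
have [|||c sc] := IH D'.
- rewrite -ltnS; apply: leq_trans ltN; rewrite ltnS; apply: proper_card.
  apply/properP; split; last first.
    exists (s, t); first by rewrite !inE sS tT nst.
    by rewrite !inE /D' /= !eqxx orbT andbF.
  by apply/subsetP=> -[u v]; rewrite !inE /D' /= negb_or => /andP[-> /andP[-> _]].
- move=> A AS A0; have [a aA ha] := hS A AS A0; exists a => //.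
  by apply: leq_trans ha _; rewrite leq_mul2l /= subset_leq_card // setSI.
- move=> A AS A0; have [a aA ha] := hT A AS A0; exists a => //.
  by apply: leq_trans ha _; rewrite leq_mul2l /= subset_leq_card // setSI.
have szc : size c = #|S| + #|T|.
  case: sc => un _ eqc; rewrite -(card_uniqP un) (eq_card eqc).
  by have := cardsUI S T; rewrite (disjoint_setI0 dis) cards0 addn0.
have T1 : 1 < #|T|.
  have [||a /set1P-> ha] := hS [set s].
  - by rewrite sub1set.
  - by apply/set0Pn; exists s; rewrite inE.
  rewrite cards1 in ha.
  have /card_gt0P[t' ] : 0 < #|out D s :&: T| by lia.
  rewrite !inE => /andP[st' t'T].
  apply/card_gt1P; exists t', t; split=> //.
  by apply: contraNneq nst => <-.
have [|//|[p [sp lp]]] := scycle_del_arc dis sS tT _ sc; first by lia.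
case: (ltnP #|S| (f (s, t))) => [lt|le].
  by apply: (bip_close dis sp) => //; rewrite lp.
exfalso; rewrite /f /= in le.
have mxE u v : u \in S -> v \in T -> ~~ D u v -> f (u, v) <= f (s, t).
  by move=> uS vT nuv; apply: mx; rewrite inE /= uS vT.
(* Non-neighbours of [t] have degree at most that of [s], by the choice of
   [(s, t)], and conversely. *)
have cA : #|S :\: out (conv D) t| = #|S| - #|out (conv D) t :&: S| by rewrite cardsD setIC.
have cB : #|T :\: out D s| = #|T| - #|out D s :&: T| by rewrite cardsD setIC.
have [||a aA ha] := hS (S :\: out (conv D) t).
- exact: subsetDl.
- by apply/set0Pn; exists s; rewrite !inE sS andbT.
have [||b bB hb] := hT (T :\: out D s).
- exact: subsetDl.
- by apply/set0Pn; exists t; rewrite !inE tT andbT.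
move: aA bB; rewrite !inE /conv => /andP[nat aS] /andP[nsb bT].
have := mxE a t aS tT nat; have := mxE s b sS bT nsb; rewrite /f /=.
by lia.
Qed.

End Ham.

(** * Counting, and paths with an even number of vertices *)

(** Hypotheses on set membership only slow [lia] down. *)
Ltac lia_nat :=
  repeat match goal with
  | H : is_true (leq _ _) |- _ => revert H
  | H : @eq nat _ _ |- _ => revert H
  end; clear; intros; lia.

Section Even.
Variable V : finType.
Implicit Types (D : rel V) (S T A X Z : {set V}) (p q c : seq V) (x y z s t u v : V).

Lemma spath_conv D S T p : spath D S T p -> spath (conv D) T S p.
Proof.
case=> un so e; split=> //; last by rewrite setUC.
by case: p so {un e} => //= x p; rewrite (eq_path (@bip_conv _ D S T)).
Qed.

Lemma scycle_conv D S T c : scycle D S T c -> scycle (conv D) T S c.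
Proof.
case=> un so e; split=> //; last by rewrite setUC.
by case: c so {un e} => //= x p; rewrite (eq_path (@bip_conv _ D S T)).
Qed.

Lemma spath_rev D S T x p : spath D S T (x :: p) ->
  spath D S T (last x p :: rev (belast x p)) /\
  last (last x p) (rev (belast x p)) = x.
Proof.
case=> un so e; rewrite -rev_rcons -lastI; split; last first.
  by case: p {un so e} => //= y p; rewrite rev_cons last_rcons.
split; [by rewrite rev_uniq| |by move=> y; rewrite mem_rev].
by rewrite rev_sorted; move: so => /=; rewrite (eq_path (@bip_sym _ D S T)).
Qed.

Lemma spath_apath D S T p : [disjoint S & T] -> spath D S T p -> apath D S T p.
Proof.
by move=> dis [un so e]; apply/and4P; split=> //; apply/allP=> y; rewrite e.
Qed.

Lemma spath_size D S T p : [disjoint S & T] -> spath D S T p -> size p = #|S| + #|T|.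
Proof.
move=> dis [un _ e]; rewrite -(card_uniqP un) (eq_card e).
by have := cardsUI S T; rewrite (disjoint_setI0 dis) cards0 addn0.
Qed.

Lemma scycle_at D S T c x : scycle D S T c -> x \in S :|: T ->
  exists q, [/\ spath D S T (x :: q), bip D S T (last x q) x & next c =1 next (x :: q)].
Proof.
case=> un cyc e xin; have [|q [pe pq nq]] := cycle_at cyc un (x := x); first by rewrite e.
move: pq; rewrite rcons_path => /andP[pq lq].
exists q; split=> //; split=> //; first by rewrite (perm_uniq pe).
by move=> y; rewrite (perm_mem pe).
Qed.

Lemma scycle_next D S T c s : [disjoint S & T] -> scycle D S T c -> s \in S ->
  next c s \in T /\ D s (next c s).
Proof.
move=> dis [un cyc e] sS; have sc : s \in c by rewrite e inE sS.
by have := next_cycle cyc sc; rewrite bip_l // => /andP[].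
Qed.

Lemma scycle_deg D d S T c s : [disjoint S & T] -> mindeg D d -> scycle D S T c ->
  s \in S -> d <= #|out D s|.
Proof. by move=> dis md sc sS; have [_ /md[]] := scycle_next dis sc sS. Qed.

(** An out-neighbour elsewhere could be put in front of the path. *)
Lemma spath_closed D S T x p : [disjoint S & T] -> spath D S T (x :: p) -> x \in S ->
  ~~ has_alt D (#|S| + #|T|).+1 -> out D x \subset S :|: T.
Proof.
move=> dis sp xS no; apply/subsetP=> y; rewrite inE => Dxy; apply: contraNT no => yn.
apply: (apath_has_alt (apath_cons_out (spath_apath dis sp) xS yn Dxy)).
by have /= -> := spath_size dis sp.
Qed.

Lemma scycle_closed D S T c s : [disjoint S & T] -> scycle D S T c -> s \in S ->
  ~~ has_alt D (#|S| + #|T|).+1 -> out D s \subset S :|: T.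
Proof.
move=> dis sc sS; have [|q [sp _ _]] := scycle_at sc (x := s); first by rewrite inE sS.
exact: (spath_closed dis sp sS).
Qed.

(** What [exists_low_out] leaves for [T] when all out-neighbours of [A] lie in
    [S :|: T], up to the exceptional set [Z]. *)
Lemma source_degree D d S T Z A : oriented D -> A \subset S -> A != set0 ->
  (forall a, a \in A -> d <= #|out D a| /\ out D a \subset S :|: T :|: Z) ->
  exists2 a, a \in A & 2 * d + #|A| < 2 * #|out D a :&: T| + 2 * #|S| + 2 * #|Z|.
Proof.
move=> orD AS A0 hA; have [a aA ha] := exists_low_out orD AS A0; exists a => //.
have [da sub] := hA a aA.
have : #|out D a| <= #|out D a :&: S| + #|out D a :&: T| + #|Z|.
  rewrite -{1}(setIidPl sub) !setIUr.
  apply: leq_trans (leq_card_setU _ _) _; apply: leq_add.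
    exact: leq_card_setU.
  by apply: subset_leq_card; apply: subsetIr.
by lia.
Qed.

Lemma rotate_head_degree D d S T x p : oriented D -> mindeg D d ->
  [disjoint S & T] -> 0 < #|T| -> #|S| <= d -> spath D S T (x :: p) -> x \in S ->
  ~~ has_alt D (#|S| + #|T|).+1 ->
  exists y q, [/\ y \in S, spath D S T (y :: q), last y q = last x p
     & 2 * d + 1 <= #|out D y :&: T| + 2 * #|S|].
Proof.
move=> orD md dis T0 Sd sp xS no.
have S0 : 0 < #|S| by apply/card_gt0P; exists x.
have nn a q : spath D S T (a :: q) -> q != [::].
  by case: q => [|//] /(spath_size dis) /= E; lia.
(* With [rotate_head], the constant is [2 d + 1 - 2 |S|], by [source_degree].
   *)
have [A AS A0 hA|||||y [q [yS sq lq hq]]] :=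
    @rotate_head _ D S T (last x p) ((2 * d).+1 - 2 * #|S|) dis _ x p.
- have [a aA|a aA ha] := @source_degree D d S T set0 A orD AS A0.
    have aS := subsetP AS a aA.
    have [q [sq _]] := hA a aA; rewrite setU0; split; last exact: (spath_closed dis sq aS no).
    case: q sq (nn _ _ sq) => // b q [_ /= /andP[+ _] _] _.
    by rewrite bip_l // => /andP[_ /md[]].
  exists a => //; rewrite cards0 in ha.
  by lia.
- by [].
- exact: nn sp.
- by [].
- by [].
by exists y, q; split=> //; lia.
Qed.

(** Let [S'] be the set of vertices of [S] with an in-neighbour in [S], [n =
    |S'|] and [m = |X|].  Write [p] for the number of arcs inside [S], all of
    which end in [S'], and [q], [w] for the numbers of arcs from [S] to [T]
    and from [T] to [S].  Then [d r <= p + q] and [d n <= p + w + m n] by the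
    degree assumptions, while [q + w <= r^2] and [2 p + n^2 <= 2 n r] as [D]
    is oriented.  Adding up, [d (r + n) <= r^2 + 2 n r - n^2 + m n]; with the
    lower bound on [d] this gives [r^2 - 3 r n + 4 n^2 <= 0], which is
    impossible as the discriminant is negative. *)
Lemma closed_absurd D d S T X r : oriented D -> #|S| = r -> #|T| = r -> 0 < r ->
  5 * r + 2 * #|X| <= 4 * d ->
  (forall s, s \in S -> d <= #|out D s| /\ out D s \subset S :|: T) ->
  (forall s u, s \in S -> u \in S -> D u s ->
     d <= #|out (conv D) s| /\ out (conv D) s \subset S :|: T :|: X) -> False.
Proof.
move=> orD cS cT r0 dr hS hS'.
pose S' := [set s in S | [exists u in S, D u s]].
have SS' : S' \subset S by apply/subsetP=> s; rewrite inE => /andP[].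
pose p := \sum_(s in S) #|out D s :&: S|.
pose q := \sum_(s in S) #|out D s :&: T|.
pose w := \sum_(s in S) #|out (conv D) s :&: T|.
have pE : p = \sum_(s in S') #|out (conv D) s :&: S|.
  rewrite /p sum_out_conv (big_setID S') /= (setIidPr SS') [X in _ + X]big1 ?addn0 //.
  move=> s; rewrite !inE => /andP[+ sS]; rewrite sS /= negb_exists_in => /forall_inP ns.
  apply/eqP; rewrite cards_eq0; apply/eqP/setP=> u; rewrite !inE /conv.
  by apply/negbTE; rewrite andbC; apply/negP=> /andP[/ns/negPf->].
have h1 : d * r <= p + q.
  rewrite -cS mulnC -sum_nat_const -big_split /=; apply: leq_sum => s sS.
  have [ds sub] := hS s sS; apply: leq_trans ds _.
  by rewrite -{1}(setIidPl sub) setIUr leq_card_setU.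
have h2 : d * #|S'| <= p + w + #|X| * #|S'|.
  have : \sum_(s in S') (#|out (conv D) s :&: T|) <= w.
    by rewrite /w [X in _ <= X](big_setID S') /= (setIidPr SS') leq_addr.
  have : d * #|S'| <= \sum_(s in S') (#|out (conv D) s :&: S| + #|out (conv D) s :&: T| + #|X|).
    rewrite mulnC -sum_nat_const; apply: leq_sum => s; rewrite inE => /andP[sS /exists_inP[u uS Dus]].
    have [ds sub] := hS' s u sS uS Dus; apply: leq_trans ds _.
    rewrite -{1}(setIidPl sub) !setIUr; apply: leq_trans (leq_card_setU _ _) _.
    apply: leq_add; first exact: leq_card_setU.
    by rewrite subset_leq_card // subsetIr.
  by rewrite !big_split /= -pE sum_nat_const; lia.
have h3 : q + w <= r * r.
  rewrite -{1}cS -cT -sum_nat_const -big_split /=; apply: leq_sum => s _.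
  exact: out_in_leq.
have h4 : 2 * p + #|S'| * #|S'| <= 2 * (#|S'| * r).
  have split_in s : #|out (conv D) s :&: S| <= #|out (conv D) s :&: S'| + (r - #|S'|).
    rewrite -cS -(setIidPr SS') -cardsD -{1}(setID S S') setIUr.
    apply: leq_trans (leq_card_setU _ _) _; rewrite (setIidPr SS').
    by rewrite leq_add2l subset_leq_card // subsetIr.
  have : p <= \sum_(s in S') (#|out (conv D) s :&: S'| + (r - #|S'|)).
    by rewrite pE; apply: leq_sum.
  have : \sum_(s in S') (#|out D s :&: S'| + #|out (conv D) s :&: S'|) <= #|S'| * #|S'|.
    by rewrite -sum_nat_const; apply: leq_sum => s _; apply: out_in_leq.
  rewrite !big_split /= sum_out_conv sum_nat_const.
  have := subset_leq_card SS'; rewrite cS mulnBr.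
  set e := \sum_(_ in _) _; nia.
have : #|S'| <= r by rewrite -cS subset_leq_card.
move: #|S'| #|X| h2 h4 dr => n m h2 h4 dr nr.
(* The remaining bounds make the final inequality linear in the products of
   [r], [n], [m] and [d]; [h7] is [0 <= (r - 2 n) ^ 2]. *)
have h5 : (5 * r + 2 * m) * (r + n) <= 4 * d * (r + n) by rewrite leq_mul2r dr orbT.
have h6 : m * n <= m * r by rewrite leq_mul2l nr orbT.
have h7 : 4 * (r * n) <= r * r + 4 * (n * n).
  by have [+ _] := nat_Cauchy r (2 * n); rewrite -!mulnn; lia.
have h8 : 0 < r * r by rewrite muln_gt0 r0.
clear -h1 h2 h3 h4 h5 h6 h7 h8.
move: p q w h1 h2 h3 h4 => p q w h1 h2 h3 h4.
rewrite !mulnDl !mulnDr in h5.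
lia.
Qed.

Lemma even_extend D d S T x p : oriented D -> mindeg D d -> [disjoint S & T] ->
  #|S| = #|T| -> 5 * #|S| + 3 <= 4 * d -> spath D S T (x :: p) ->
  x \in S -> last x p \in T -> has_alt D (2 * #|S|).+1.
Proof.
move=> orD md dis eST dr sp xS zT; apply: contraT => no.
have no' : ~~ has_alt D (#|S| + #|T|).+1 by rewrite -eST addnn -mul2n.
have noC : ~~ has_alt (conv D) (#|T| + #|S|).+1 by rewrite has_alt_conv addnC.
have S0 : 0 < #|S| by apply/card_gt0P; exists x.
have disC : [disjoint T & S] by rewrite disjoint_sym.
have orC := oriented_conv orD.
have mdC := mindeg_conv md.
have [c sc] : exists c, scycle D S T c.
  have [||y [q [yS sq lq hq]]] := rotate_head_degree orD md dis _ _ sp xS no'.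
  - by rewrite -eST.
  - by lia_nat.
  have [sq' lq'] := spath_rev sq.
  have := spath_conv sq'; rewrite lq => {}sq'.
  have [|||z [q2 [zT2 sq2 lq2 hq2]]] := rotate_head_degree orC mdC disC _ _ sq' _ noC => //.
    by lia_nat.
  have [/spath_conv sq3 lq3] := spath_rev sq2.
  rewrite -lq lq' in lq2; rewrite lq2 in sq3 lq3.
  have {}sq3 : spath D S T (y :: rev (belast z q2)) := sq3.
  apply: (bip_close dis sq3) => //; first by rewrite lq3.
  by rewrite lq3; lia_nat.
have outS s : s \in S -> out D s \subset S :|: T.
  by move=> sS; exact: (scycle_closed dis sc sS no').
have inT t : t \in T -> out (conv D) t \subset S :|: T.
  by move=> tT; rewrite setUC; exact: (scycle_closed disC (scycle_conv sc) tT noC).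
exfalso; apply: (@closed_absurd D d S T set0 #|S|) => //.
- by rewrite cards0; lia_nat.
- by move=> s sS; split; [exact: (scycle_deg dis md sc sS)|apply: outS].
move=> s' s s'S sS Dss'; split; first by have [] := md _ _ Dss'.
apply/subsetP=> x'; rewrite inE /conv setU0 => Dx's'; apply: contraT => x'n.
(* By [inT], [x'] has no out-neighbour in [T], and [S] is too small to contain
   all of them. *)
have [y Dx'y yn] : exists2 y, D x' y & y \notin S :|: T.
  have [dx _] := md _ _ Dx's'.
  have : #|out D x'| <= #|out D x' :&: S| + #|out D x' :\: S|.
    by rewrite cardsID.
  have := subset_leq_card (subsetIr (out D x') S) => ? ?.
  have /card_gt0P[y] : 0 < #|out D x' :\: S| by lia_nat.
  rewrite !inE => /andP[yS Dx'y]; exists y => //.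
  rewrite !inE (negPf yS) /=; apply: contra x'n => yT.
  by apply: (subsetP (inT y yT)); rewrite inE.
have /card_gt0P[t0 t0T] : 0 < #|T| by rewrite -eST.
have dis' : [disjoint S :\ s' & T :\ t0].
  by apply: disjointW dis; apply: subsetDl.
have cS' : #|S| = (#|S :\ s'|).+1 by rewrite (cardsD1 s') s'S.
have cT' : #|T| = (#|T :\ t0|).+1 by rewrite (cardsD1 t0) t0T.
have ss' : s \in S :\ s'.
  by rewrite !inE sS andbT; apply: contraTneq Dss' => ->; rewrite (proj1 orD).
have [||A AS A0|A AT A0||c' sc'] :=
   @ham_cycle _ D (S :\ s') (T :\ t0) ((2 * d).-1 - 2 * #|S|) ((2 * d).-1 - 2 * #|S|) dis'.
- by apply/eqP; rewrite -eqSS -cS' -cT' eST.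
- by apply/card_gt0P; exists s.
- have AS' := subset_trans AS (subsetDl _ _).
  have [a aA|a aA ha] := @source_degree D d S T set0 A orD AS' A0.
    have aS := subsetP AS' a aA; split; first exact: (scycle_deg dis md sc aS).
    by rewrite setU0 outS.
  exists a => //; rewrite cards0 in ha.
  have := cardsD1 t0 (out D a :&: T); rewrite -setIDA.
  by have := subset_leq_card AS'; lia_nat.
- have AT' := subset_trans AT (subsetDl _ _).
  have [a aA|a aA ha] := @source_degree (conv D) d T S set0 A orC AT' A0.
    have aT := subsetP AT' a aA; split; first exact: (scycle_deg disC mdC (scycle_conv sc) aT).
    by rewrite setU0 setUC inT.
  exists a => //; rewrite cards0 in ha.
  have := cardsD1 s' (out (conv D) a :&: S); rewrite -setIDA.
  by have := subset_leq_card AT'; lia_nat.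
- by lia_nat.
have [|q [sq _ _]] := scycle_at sc' (x := s); first by rewrite inE ss'.
have szq := spath_size dis' sq.
have ap0 := spath_apath dis' sq.
have s'T : s' \notin T by rewrite (disjointFr dis).
have ap1 : apath D (S :\ s') (s' |: T :\ t0) (s' :: s :: q).
  by apply: (apath_cons_out ap0 ss' _ Dss'); rewrite !inE eqxx (negPf s'T) andbF.
have x's' : x' != s' by apply: contraNneq x'n => ->; rewrite inE s'S.
have ap2 : apath D (x' |: S :\ s') (s' |: T :\ t0) (x' :: s' :: s :: q).
  apply: (apath_cons_in ap1 _ _ Dx's'); first by rewrite setU11.
  by move: x'n; rewrite !inE (negPf x's') => /norP[/negPf-> /negPf->]; rewrite !andbF.
have ap3 : apath D (x' |: S :\ s') (y |: (s' |: T :\ t0)) [:: y, x', s', s & q].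
  apply: (apath_cons_out ap2 _ _ Dx'y); first by rewrite setU11.
  have yx : y != x' by apply: contraTneq Dx'y => ->; rewrite (proj1 orD).
  have ys : y != s' by apply: contraNneq yn => ->; rewrite inE s'S.
  by move: yn; rewrite !inE (negPf yx) (negPf ys) => /norP[/negPf-> /negPf->]; rewrite !andbF.
case/negP: no; apply: apath_has_alt ap3 _.
by move: szq => /=; lia_nat.
Qed.

End Even.

(** * Paths with an odd number of vertices *)

Section Odd.
Variable V : finType.
Implicit Types (D : rel V) (S T A X Z : {set V}) (p q c : seq V) (x y z s t u v : V).

(** The cycle found in the odd case together with the assumption that is to be
    refuted.  It is stable under the reversal of [D], see [unextendable_conv].
    *)
Definition unextendable_cycle D d S T c r : Prop :=
  [/\ oriented D, mindeg D d, [disjoint S & T], scycle D S T c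
    & [/\ #|S| = r, #|T| = r, 5 * r + 6 <= 4 * d & ~~ has_alt D (2 * r).+2]].

(** The set [X] of the introduction; the set [Y] is [outer (conv D) T S]. *)
Definition outer D S T : {set V} :=
  [set x | (x \notin S :|: T) && [exists t in T, D x t]].

Lemma unextendable_conv D d S T c r : unextendable_cycle D d S T c r -> unextendable_cycle (conv D) d T S c r.
Proof.
case=> orD md dis sc [cS cT dr no]; split.
- exact: oriented_conv.
- exact: mindeg_conv.
- by rewrite disjoint_sym.
- exact: scycle_conv.
- by split=> //; rewrite has_alt_conv.
Qed.

Lemma outer_conv D S T y : y \in outer (conv D) T S ->
  y \notin S :|: T /\ exists2 s, s \in S & D s y.
Proof. by rewrite inE setUC => /andP[? /exists_inP[s sS Dsy]]; split=> //; exists s. Qed.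

Lemma outerP D S T x : x \in outer D S T ->
  x \notin S :|: T /\ exists2 t, t \in T & D x t.
Proof. by rewrite inE => /andP[? /exists_inP[s sS Dsy]]; split=> //; exists s. Qed.

(** Cutting the cycle next to a neighbour of [x] and putting [x] in front
    gives a path on [2 r + 1] vertices with first vertex [x]. *)
Lemma outer_closed D d S T c r x : unextendable_cycle D d S T c r -> x \in outer D S T ->
  out D x \subset S :|: T.
Proof.
case=> orD md dis sc [cS cT dr no] /outerP[xn [t tT Dxt]].
have [|q [sq _ _]] := scycle_at sc (x := t); first by rewrite inE tT orbT.
have ap1 := apath_cons_in (spath_apath dis sq) tT xn Dxt.
apply/subsetP=> y; rewrite inE => Dxy; apply: contraNT no => yn.
apply: (apath_has_alt (apath_cons_out ap1 _ _ Dxy)); first exact: setU11.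
  have yx : y != x by apply: contraTneq Dxy => ->; rewrite (proj1 orD).
  by move: yn; rewrite !inE (negPf yx).
by have /= -> := spath_size dis sq; rewrite cS cT; lia_nat.
Qed.

Lemma outer_degree D d S T c r x : unextendable_cycle D d S T c r -> x \in outer D S T ->
  d <= #|out D x :&: S| + #|out D x :&: T|.
Proof.
move=> tc xX; have sub := outer_closed tc xX.
have [_ [t _ Dxt]] := outerP xX; have [_ md _ _ _] := tc.
have [dx _] := md _ _ Dxt; apply: leq_trans dx _.
by rewrite -{1}(setIidPl sub) setIUr leq_card_setU.
Qed.

(** The at least [d] in-neighbours and at least [d] out-neighbours of [x]
    would be distinct vertices of the cycle, which has only [2 r < 2 d]. *)
Lemma outer_disjoint D d S T c r x : unextendable_cycle D d S T c r -> x \in outer D S T ->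
  x \in outer (conv D) T S -> False.
Proof.
move=> tc xX xY; have [orD _ dis _ [cS cT dr _]] := tc.
have h1 := outer_degree tc xX.
have h2 := outer_degree (unextendable_conv tc) xY.
have h3 := out_in_leq S x orD; have h4 := out_in_leq T x orD.
by rewrite cS in h3; rewrite cT in h4; lia_nat.
Qed.

Lemma spath_behead D S T s p : [disjoint S & T] -> s \in S -> spath D S T (s :: p) ->
  spath D (S :\ s) T p.
Proof.
move=> dis sS [/= /andP[sp un] so e]; split=> //.
  case: p sp so {un e} => //= t p sp /andP[_ so].
  apply: (sub_in_path (P := predC1 s)) so => [a b|].
    by rewrite /bip !inE => /negPf-> /negPf->.
  by apply/allP=> y yp; apply: contraNneq sp => <-.
move=> y; have := e y; rewrite !inE; case: eqP => [->|_ /= -> //].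
by rewrite (disjointFr dis sS) (negPf sp).
Qed.

(** Remove [s] from the cycle: the rest is a path starting at [next c s].  Put
    [x1], [s], [x] in front of it, with [s] now serving as a sink. *)
Lemma swap_clash D d S T c r x x1 s : unextendable_cycle D d S T c r ->
  x \notin S :|: T -> x1 \notin S :|: T -> x1 != x -> s \in S ->
  D x s -> D x (next c s) -> D x1 s -> False.
Proof.
move=> [orD md dis sc [cS cT dr no]] xn x1n x1x sS Dxs Dxt Dx1s.
have [tT _] := scycle_next dis sc sS.
have [|q [sq _ nq]] := scycle_at sc (x := s); first by rewrite inE sS.
have sz := spath_size dis sq; rewrite nq in tT Dxt.
case: q sq {nq} sz tT Dxt => [|t q] sq sz /=; rewrite eqxx.
  by rewrite (disjointFr dis sS).
move=> tT Dxt.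
have dis' : [disjoint S :\ s & T] by apply: disjointWl dis; apply: subsetDl.
have ap0 := spath_apath dis' (spath_behead dis sS sq).
have sT : s \notin T by rewrite (disjointFr dis).
have xs : s != x by apply: contraNneq xn => <-; rewrite inE sS.
have x1s : x1 != s by apply: contraNneq x1n => ->; rewrite inE sS.
have ap1 : apath D (x |: S :\ s) T [:: x, t & q].
  apply: (apath_cons_in ap0 tT _ Dxt).
  by move: xn; rewrite !inE => /norP[/negPf-> /negPf->]; rewrite andbF.
have ap2 : apath D (x |: S :\ s) (s |: T) [:: s, x, t & q].
  apply: (apath_cons_out ap1 _ _ Dxs); first exact: setU11.
  by rewrite !inE eqxx (negPf xs) (negPf sT).
have ap3 : apath D (x1 |: (x |: S :\ s)) (s |: T) [:: x1, s, x, t & q].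
  apply: (apath_cons_in ap2 _ _ Dx1s); first exact: setU11.
  move: x1n; rewrite !inE (negPf x1s) (negPf x1x) => /norP[/negPf-> /negPf->].
  by [].
by case/negP: no; apply: (apath_has_alt ap3); move: sz => /=; lia_nat.
Qed.

(** The sources [s] that [swap_clash] protects from arcs coming from vertices
    outside the cycle other than [x]. *)
Definition swaps D S c x : {set V} := [set s in S | D x s && D x (next c s)].

(** Out of the [r] sources of the cycle, [x] sends arcs to some and to the
    successors of some; as [x] has out-degree at least [d], at least [d - r]
    sources are of both kinds. *)
Lemma swaps_card D d S T c r x : unextendable_cycle D d S T c r -> x \in outer D S T ->
  d - r <= #|swaps D S c x|.
Proof.
move=> tc xX; have hd := outer_degree tc xX.
have [orD md dis sc [cS cT dr no]] := tc.
have [un cyc ec] := sc.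
set P := [set prev c t | t in out D x :&: T].
have cP : #|P| = #|out D x :&: T| by apply: card_imset; apply: can_inj (next_prev un).
have PS : P \subset S.
  apply/subsetP=> _ /imsetP[t /setIP[_ tT] ->].
  have tc' : t \in c by rewrite ec inE tT orbT.
  by have := prev_cycle cyc tc'; rewrite bip_sym bip_r // => /andP[].
have sub : (out D x :&: S) :&: P \subset swaps D S c x.
  apply/subsetP=> s /setIP[/setIP[xs sS] /imsetP[t /setIP[xt _] Es]].
  by rewrite !inE in xs xt; rewrite inE sS xs Es next_prev // xt.
have := subset_leq_card sub.
have : #|(out D x :&: S) :|: P| <= r.
  by rewrite -cS subset_leq_card // subUset PS subsetIr.
have := cardsUI (out D x :&: S) P; rewrite cP; lia_nat.
Qed.

(** By [swap_clash] the out-neighbours of [x] in [S] and the sets [swaps D S c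
    u], for the other vertices [u] of [outer D S T], are pairwise disjoint. *)
Lemma outer_count D d S T c r x : unextendable_cycle D d S T c r -> x \in outer D S T ->
  #|out D x :&: S| + (#|outer D S T| - 1) * (d - r) <= r.
Proof.
move=> tc xX; have [orD md dis sc [cS cT dr no]] := tc.
set X := outer D S T in xX *.
have cX : #|X| - 1 = #|X :\ x| by rewrite (cardsD1 x X) xX add1n subn1.
have notin u : u \in X -> u \notin S :|: T by case/outerP.
have h1 : (#|X| - 1) * (d - r) <= \sum_(u in X :\ x) #|swaps D S c u|.
  rewrite cX -sum_nat_const; apply: leq_sum => u; rewrite inE => /andP[_ uX].
  exact: swaps_card tc uX.
apply: leq_trans (leq_add (leqnn _) h1) _; clearbody X; clear cX h1.
have -> : \sum_(u in X :\ x) #|swaps D S c u| =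
    \sum_(s in S) #|[set u in X :\ x | s \in swaps D S c u]|.
  have E u : #|swaps D S c u| = \sum_(s in S) (s \in swaps D S c u).
    rewrite -sum1_card [RHS]big_mkcond [LHS]big_mkcond; apply: eq_bigr => s _.
    by rewrite inE; case: (s \in S).
  rewrite (eq_bigr _ (fun u _ => E u)) exchange_big; apply: eq_bigr => s _.
  rewrite -sum1_card [LHS]big_mkcond [RHS]big_mkcond; apply: eq_bigr => u _.
  by rewrite [in RHS]inE; case: (u \in X :\ x) => //=; case: (s \in _).
have -> : #|out D x :&: S| = \sum_(s in S) D x s.
  rewrite -sum1_card [RHS]big_mkcond [LHS]big_mkcond; apply: eq_bigr => s _.
  by rewrite !inE; case: (s \in S); case: (D x s).
rewrite -big_split /= -[in X in _ <= X]cS -sum1_card; apply: leq_sum => s sS.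
case Dxs: (D x s).
  rewrite (_ : [set u in _ | _] = set0) ?cards0 //.
  apply/setP=> u; rewrite !inE; apply/negbTE; apply/negP.
  case/andP=> /andP[ux uX] /andP[_ /andP[Dus Dut]].
  by apply: (swap_clash tc (notin u uX) (notin x xX) _ sS Dus Dut Dxs); rewrite eq_sym.
rewrite add0n; apply/card_le1P=> u; rewrite !inE => /andP[/andP[ux uX] /andP[_ /andP[Dus Dut]]].
move=> v; rewrite !inE; apply/idP/eqP => [|->].
  case/andP=> /andP[vx vX] /andP[_ /andP[Dvs Dvt]].
  apply/eqP; apply: contraT => vu; exfalso.
  by apply: (swap_clash tc (notin u uX) (notin v vX) _ sS Dus Dut Dvs).
by rewrite ux uX sS Dus Dut.
Qed.

(** By [outer_count], [outer D S T] has at most [r / (d - r) < 4] elements. *)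
Lemma outer_le3 D d S T c r : unextendable_cycle D d S T c r -> #|outer D S T| <= 3.
Proof.
move=> tc; have [E|[x xX]] := set_0Vmem (outer D S T); first by rewrite E cards0.
have h1 := outer_count tc xX; have h2 := outer_degree tc xX.
have [_ _ _ _ [_ cT dr _]] := tc.
have h3 := subset_leq_card (subsetIr (out D x) T); rewrite cT in h3.
rewrite leqNgt; apply/negP=> h4.
have h5 : 3 * (d - r) <= (#|outer D S T| - 1) * (d - r) by rewrite leq_mul2r; apply/orP; right; lia_nat.
by lia_nat.
Qed.

(** Another vertex of [outer D S T] takes at least [d - r] sources away from
    [x], which therefore has more neighbours among the sinks. *)
Lemma outer_two D d S T c r x : unextendable_cycle D d S T c r -> x \in outer D S T ->
  2 <= #|outer D S T| -> 2 * (d - r) <= #|out D x :&: T|.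
Proof.
move=> tc xX n2; have h1 := outer_count tc xX; have h2 := outer_degree tc xX.
have [_ _ _ _ [_ _ dr _]] := tc.
have h5 : 1 * (d - r) <= (#|outer D S T| - 1) * (d - r) by rewrite leq_mul2r; apply/orP; right; lia_nat.
by lia_nat.
Qed.

(** The cycle cut between [s] and its successor, with [y] put before [s] and
    [x] before the successor, would have [2 r + 2] vertices. *)
Lemma outer_far D d S T c r x y s : unextendable_cycle D d S T c r ->
  x \in outer D S T -> y \in outer (conv D) T S ->
  s \in S -> D s y -> D x (next c s) -> False.
Proof.
move=> tc xX yY sS Dsy Dxt.
have xy : y != x by apply/eqP=> E; rewrite E in yY; exact: outer_disjoint tc xX yY.
have [orD md dis sc [cS cT dr no]] := tc.
have [xn _] := outerP xX; have [yn _] := outer_conv yY.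
have [tT _] := scycle_next dis sc sS; set t := next c s in tT Dxt.
have [|q [sq _ nq]] := scycle_at sc (x := t); first by rewrite inE tT orbT.
have lq : last t q = s.
  have [un _ _] := sc; apply: (can_inj (prev_next un)).
  by rewrite nq next_last //; case: sq.
have ap1 := apath_cons_in (spath_apath dis sq) tT xn Dxt.
rewrite -apath_rev lastI rev_rcons /= lq in ap1.
have ap2 : apath D (x |: S) (y |: T) (y :: s :: rev (x :: belast t q)).
  apply: (apath_cons_out ap1 _ _ Dsy); first by rewrite inE sS orbT.
  by move: yn; rewrite !inE (negPf xy).
case/negP: no; apply: (apath_has_alt ap2).
by rewrite /= size_rev /= size_belast; have /= := spath_size dis sq; rewrite cS cT; lia_nat.
Qed.

(** By [outer_far] the out-neighbours of [x] in [T] avoid the successors of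
    the in-neighbours of [y] in [S], of which there are at least [d - r].  So
    [x] has at least [2 (d - r)] out-neighbours in [S], and [outer_count]
    gives less room than in [outer_le3]. *)
Lemma outer_le2 D d S T c r y : unextendable_cycle D d S T c r ->
  y \in outer (conv D) T S -> #|outer D S T| <= 2.
Proof.
move=> tc yY; have [E|[x xX]] := set_0Vmem (outer D S T); first by rewrite E cards0.
have h1 := outer_count tc xX; have h2 := outer_degree tc xX.
have h3 := outer_degree (unextendable_conv tc) yY.
have [_ _ dis sc [cS cT dr _]] := tc.
have [un cyc ec] := sc.
have h4 : #|out (conv D) y :&: T| <= r by rewrite -cT subset_leq_card // subsetIr.
have h5 : #|out (conv D) y :&: S| + #|out D x :&: T| <= r.
  set M := out (conv D) y :&: S.
  have cM : #|[set next c s | s in M]| = #|M|.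
    by apply: card_imset; apply: can_inj (prev_next un).
  have MT : [set next c s | s in M] \subset T.
    by apply/subsetP=> _ /imsetP[s /setIP[_ sS] ->]; have [] := scycle_next dis sc sS.
  have I0 : [set next c s | s in M] :&: (out D x :&: T) = set0.
    apply/setP=> t; rewrite !inE; apply/negbTE/negP=> /andP[/imsetP[s /setIP[ys sS] Et] /andP[xt _]].
    by rewrite inE in ys; apply: (outer_far tc xX yY sS ys); rewrite -Et.
  have := cardsUI [set next c s | s in M] (out D x :&: T).
  have : #|[set next c s | s in M] :|: (out D x :&: T)| <= r.
    by rewrite -cT subset_leq_card // subUset MT subsetIr.
  by rewrite I0 cards0 cM; lia_nat.
rewrite leqNgt; apply/negP=> n3.
have h6 : 2 * (d - r) <= (#|outer D S T| - 1) * (d - r) by rewrite leq_mul2r; apply/orP; right; lia_nat.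
by lia_nat.
Qed.

Lemma source_closed D d S T c r s : unextendable_cycle D d S T c r -> s \in S ->
  out D s \subset S :|: T :|: outer (conv D) T S.
Proof.
move=> tc sS; apply/subsetP=> y; rewrite !inE => Dsy.
case: (y \in S) => //=; case: (y \in T) => //=.
by apply/exists_inP; exists s.
Qed.

Lemma card_sub_setU1 S A x : A \subset x |: S -> #|A| <= #|A :&: S| + 1.
Proof.
move=> AS; rewrite -(cardsID S A) leq_add2l -(cards1 x) subset_leq_card //.
apply/subsetP=> a /setDP[/(subsetP AS)] + aS.
by rewrite !inE (negPf aS) orbF.
Qed.

Lemma mem_sub_setU1 S A x : A \subset x |: S -> A != set0 -> A :&: S = set0 -> x \in A.
Proof.
move=> AS /set0Pn[a aA] E; have := subsetP AS a aA; rewrite !inE => /predU1P[<- //|aS].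
by have := in_set0 a; rewrite -E inE aA aS.
Qed.

(** The degree bounds required by [ham_cycle].  A loss of [2] comes from the
    possible second vertex of [outer (conv D) T S], which is not among the
    sinks. *)
Lemma augmented_degree D d S T c r x y A : unextendable_cycle D d S T c r ->
  x \in outer D S T -> y \in outer (conv D) T S ->
  A \subset x |: S -> A != set0 ->
  exists2 a, a \in A & #|A| + (2 * (d - r) - 2) <= 2 * #|out D a :&: (y |: T)|.
Proof.
move=> tc xX yY AS A0; have [orD md dis sc [cS cT dr no]] := tc.
have le2 := outer_le2 (unextendable_conv tc) xX.
have cA := card_sub_setU1 AS.
have [E|A0'] := eqVneq (A :&: S) set0.
  exists x; first exact: mem_sub_setU1 AS A0 E.
  have h := outer_degree tc xX.
  have h2 : #|out D x :&: T| <= #|out D x :&: (y |: T)| by rewrite subset_leq_card // setIS // subsetUr.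
  have h3 : #|out D x :&: S| <= r by rewrite -cS subset_leq_card // subsetIr.
  by rewrite E cards0 in cA; lia_nat.
have [a aA|a aA ha] := @source_degree _ D d S (y |: T) (outer (conv D) T S :\ y) _ orD (subsetIr A S) A0'.
  move: aA; rewrite inE => /andP[_ aS]; split; first exact: (scycle_deg dis md sc aS).
  apply: subset_trans (source_closed tc aS) _; apply/subsetP=> v; rewrite !inE.
  case: (v == y); first by rewrite orbT.
  by case: (v \in S); case: (v \in T).
exists a; first by move: aA; rewrite inE => /andP[].
have := cardsD1 y (outer (conv D) T S); rewrite yY cS in ha *.
by lia_nat.
Qed.

Lemma outer_not_both D d S T c r x y : unextendable_cycle D d S T c r ->
  x \in outer D S T -> y \in outer (conv D) T S -> False.
Proof.
move=> tc xX yY; have [orD md dis sc [cS cT dr no]] := tc.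
have [xn _] := outerP xX; have [yn _] := outer_conv yY.
have xy : x == y = false.
  by apply/eqP=> E; rewrite -E in yY; exact: outer_disjoint tc xX yY.
move: (xn) (yn); rewrite !inE => /norP[xS xT] /norP[yS yT].
have dis' : [disjoint x |: S & y |: T].
  rewrite disjoint_setU1 disjoint_sym disjoint_setU1 disjoint_sym dis.
  by rewrite !inE xy (negPf xT) yS.
have cS' : #|x |: S| = r.+1 by rewrite cardsU1 xS cS.
have cT' : #|y |: T| = r.+1 by rewrite cardsU1 yT cT.
have [||A AS A0|A AT A0||c' sc'] :=
   @ham_cycle _ D (x |: S) (y |: T) (2 * (d - r) - 2) (2 * (d - r) - 2) dis'.
- by rewrite cS' cT'.
- by rewrite cS'.
- exact: augmented_degree tc xX yY AS A0.
- exact: augmented_degree (unextendable_conv tc) yY xX AT A0.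
- by rewrite cS'; lia_nat.
have [|q [sq _ _]] := scycle_at sc' (x := x); first by rewrite inE setU11.
case/negP: no; apply: (apath_has_alt (spath_apath dis' sq)).
by rewrite (spath_size dis' sq) cS' cT'; lia_nat.
Qed.

(** The case where nothing outside the cycle has an in-neighbour in [S]; by
    [outer_not_both] this is the only one. *)
Lemma outer_absurd D d S T c r x : 0 < r -> unextendable_cycle D d S T c r ->
  x \in outer D S T -> False.
Proof.
move=> r0 tc xX; have [orD md dis sc [cS cT dr no]] := tc.
have Y0 : outer (conv D) T S = set0.
  by apply/setP=> y; rewrite in_set0; apply/negP=> yY; exact: outer_not_both tc xX yY.
have outS s : s \in S -> out D s \subset S :|: T.
  by move=> sS; have := source_closed tc sS; rewrite Y0 setU0.
have le3 := outer_le3 tc.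
apply: (@closed_absurd _ D d S T (outer D S T) r) => //; first by lia_nat.
  by move=> s sS; split; [exact: (scycle_deg dis md sc sS)|exact: outS].
move=> s' s s'S sS Dss'; split; first by have [] := md _ _ Dss'.
apply/subsetP=> x'; rewrite inE /conv => Dx's'; apply: contraT => x'n; exfalso.
have [xn _] := outerP xX.
move: (xn); rewrite !inE => /norP[xS xT].
have s'x : s' != x by apply: contraNneq xS => <-.
have s'T : s' \notin T by rewrite (disjointFr dis).
have dis' : [disjoint x |: S :\ s' & T].
  by rewrite disjoint_setU1 xT; apply: disjointWl dis; apply: subsetDl.
have cS' : #|x |: S :\ s'| = r.
  rewrite cardsU1 !inE (negPf xS) andbF /= add1n -cS [in RHS](cardsD1 s') s'S.
  by [].
have sin : s \in x |: S :\ s'.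
  rewrite !inE sS andbT; apply/orP; right.
  by apply: contraTneq Dss' => ->; rewrite (proj1 orD).
have cnt := outer_count tc xX.
have dgx := outer_degree tc xX.
have dgT : #|out D x :&: T| <= r by rewrite -cT subset_leq_card // subsetIr.
have dgS : #|out D x :&: S| <= r by rewrite -cS subset_leq_card // subsetIr.
have X1 : 0 < #|outer D S T| by apply/card_gt0P; exists x.
have dg2 := outer_two tc xX.
(* The loss of [1] in [kS] is due to the singleton [x], and is avoided by
   [outer_two] when there is a second vertex; this matters when there are
   three. *)
pose kS := 2 * (d - r) - (#|outer D S T| == 1).
pose kT := 2 * (d - r) + 1 - 2 * #|outer D S T|.
(* The first part says that the subtraction in [kT] is not truncated. *)
have hk : 2 * #|outer D S T| <= 2 * (d - r) + 1 /\ r < kS + kT.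
  rewrite /kS /kT; move: cnt X1 le3 dgx dgT dr; clear.
  by case: #|outer D S T| => [|[|[|[|n]]]] //=; lia.
have [hk1 hk2] := hk.
have [||A AS A0|A AT A0||c' sc'] := @ham_cycle _ D (x |: S :\ s') T kS kT dis'.
- by rewrite cS' cT.
- by rewrite cS'.
- have AS' : A \subset x |: S.
    by apply: subset_trans AS _; apply: setUS; apply: subsetDl.
  have cA := card_sub_setU1 AS'.
  have [E|A0'] := eqVneq (A :&: S) set0.
    exists x; first exact: mem_sub_setU1 AS' A0 E.
    rewrite E cards0 in cA; rewrite /kS.
    have [n1|n1] := eqVneq #|outer D S T| 1; first by rewrite /=; lia_nat.
    have {}dg2 : 2 * (d - r) <= #|out D x :&: T| by apply: dg2; rewrite ltn_neqAle eq_sym n1.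
    by rewrite subn0; lia_nat.
  have [a aA|a aA ha] := @source_degree _ D d S T set0 _ orD (subsetIr A S) A0'.
    move: aA; rewrite inE => /andP[_ aS]; split; first exact: (scycle_deg dis md sc aS).
    by rewrite setU0 outS.
  exists a; first by move: aA; rewrite inE => /andP[].
  rewrite cards0 cS in ha; have : kS <= 2 * (d - r) by rewrite leq_subr.
  by lia_nat.
- have orC := oriented_conv orD; have mdC := mindeg_conv md.
  have disC : [disjoint T & S] by rewrite disjoint_sym.
  have [a aA|a aA ha] := @source_degree _ (conv D) d T (x |: S) (outer D S T :\ x) A orC AT A0.
    have aT := subsetP AT a aA; split; first exact: (scycle_deg disC mdC (scycle_conv sc) aT).
    have sub : out (conv D) a \subset T :|: S :|: outer D S T := source_closed (unextendable_conv tc) aT.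
    apply: subset_trans sub _; apply/subsetP=> v.
    rewrite !(in_setU, in_setD, in_set1); case: eqP => [_|_] /=; rewrite ?orbT //.
  exists a => //.
  have c1 := cardsD1 x (outer D S T); rewrite xX in c1.
  have c2 : #|out (conv D) a :&: (x |: S)| <= #|out (conv D) a :&: (x |: S :\ s')| + 1.
    rewrite -(cards1 s'); apply: leq_trans (leq_card_setU _ _).
    apply: subset_leq_card; apply/subsetP=> v; rewrite !inE.
    by case: (conv D a v); case: (v == s'); case: (v == x); case: (v \in S).
  rewrite cT in ha; rewrite /kT.
  by lia_nat.
- by rewrite cS'.
have [|q [sq _ _]] := scycle_at sc' (x := s); first by rewrite inE sin.
have ap1 : apath D (x |: S :\ s') (s' |: T) [:: s', s & q].
  apply: (apath_cons_out (spath_apath dis' sq) sin _ Dss').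
  by rewrite !inE eqxx (negPf s'x) (negPf s'T).
have x's' : x' != s' by apply: contraNneq x'n => ->; rewrite !inE s'S.
have x'x : x' != x by apply: contraNneq x'n => ->; rewrite in_setU xX orbT.
have ap2 : apath D (x' |: (x |: S :\ s')) (s' |: T) [:: x', s', s & q].
  apply: (apath_cons_in ap1 _ _ Dx's'); first exact: setU11.
  move: x'n; rewrite in_setU => /norP[+ _]; rewrite !inE (negPf x's') (negPf x'x).
  by case/norP=> /negPf-> /negPf->.
case/negP: no; apply: (apath_has_alt ap2) => /=.
by have /= -> := spath_size dis' sq; rewrite cS' cT; lia_nat.
Qed.

Lemma odd_extend D d S T x p : oriented D -> mindeg D d -> [disjoint S & T] ->
  #|S| = #|T|.+1 -> 0 < #|T| -> 5 * #|T| + 6 <= 4 * d -> spath D S T (x :: p) ->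
  x \in S -> last x p \in S -> has_alt D (2 * #|T|).+2.
Proof.
move=> orD md dis cS T0 dr sp xS zS; apply: contraT => no.
have no' : ~~ has_alt D (#|S| + #|T|).+1 by rewrite cS addSn addnn -mul2n.
have Sd : #|S| <= d by lia_nat.
have [y [q [yS sq lq hq]]] := rotate_head_degree orD md dis T0 Sd sp xS no'.
have [sq' lq'] := spath_rev sq; rewrite lq in sq' lq'.
have [z [q2 [zS' sq2 lq2 hq2]]] := rotate_head_degree orD md dis T0 Sd sq' zS no'.
rewrite lq' in lq2.
have [||u [c [uS [t tT Dut] sc]]] := bip_close_odd dis sq2 zS'.
- by rewrite lq2.
- by rewrite lq2; lia_nat.
have tc : unextendable_cycle D d (S :\ u) T c #|T|.
  split=> //; first by apply: disjointWl dis; apply: subsetDl.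
  by split=> //; apply/eqP; rewrite -eqSS -cS [in X in _ == X](cardsD1 u) uS.
exfalso; apply: (outer_absurd T0 tc (x := u)).
rewrite !inE eqxx (disjointFr dis uS) /=.
by apply/exists_inP; exists t.
Qed.

End Odd.

(** * From minimum degree to long alternating paths *)

Section Final.
Variable V : finType.
Implicit Types (D : rel V) (S T A X Z : {set V}) (p q c : seq V) (x y z s t u v : V).

(** Along the path, [next] maps the sources other than the last vertex
    one-to-one onto the sinks. *)
Lemma card_sources D S T x p : [disjoint S & T] -> spath D S T (x :: p) ->
  x \in S -> #|S| = #|T| + (last x p \in S).
Proof.
move=> dis sp xS; have [un so eqp] := sp.
rewrite (cardsD1 (last x p) S) addnC; congr (_ + _); apply/eqP; rewrite eqn_leq.
rewrite -{1}(card_next (S :\ last x p) un) -{2}(card_prev T un).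
apply/andP; split; apply: subset_leq_card; apply/subsetP=> _ /imsetP[v vin ->].
  move: vin; rewrite inE => /andP[vz vS]; rewrite inE in vz.
  have vp : v \in x :: p by rewrite eqp inE vS.
  by have := path_next so un vp vz; rewrite bip_l // => /andP[].
rewrite !inE (prev_in_source dis sp xS vin) andbT; apply: contraTneq vin => E.
by rewrite -(next_prev un v) E next_last // (disjointFr dis).
Qed.

Lemma source_path_extend D d S T x p m : oriented D -> mindeg D d -> [disjoint S & T] ->
  spath D S T (x :: p) -> x \in S -> size (x :: p) = m -> 2 <= m -> 5 * m.+1 < 8 * d ->
  has_alt D m.+1.
Proof.
move=> orD md dis sp xS szp m2 dm.
have cST := card_sources dis sp xS; have szST := spath_size dis sp.
rewrite szp in szST.
have lin : last x p \in S :|: T by case: sp => _ _ <-; rewrite mem_last.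
case zS: (last x p \in S) cST lin => cST; rewrite inE zS => lin.
  have -> : m.+1 = (2 * #|T|).+2 by lia_nat.
  apply: (odd_extend orD md dis _ _ _ sp xS zS).
  - by rewrite cST addn1.
  - by lia_nat.
  - by lia_nat.
have -> : m.+1 = (2 * #|S|).+1 by lia_nat.
apply: (even_extend orD md dis _ _ sp xS lin).
- by rewrite cST addn0.
- by lia_nat.
Qed.

(** Discard the elements of [S] and [T] that the path does not visit, and
    reverse [D] if the first vertex is a sink. *)
Lemma has_alt_extend D d m : oriented D -> mindeg D d -> 2 <= m -> 5 * m.+1 < 8 * d ->
  has_alt D m -> has_alt D m.+1.
Proof.
move=> orD md m2 dm /has_altP[S [T [p [ap szp]]]].
have /and4P[dis un /allP al so] := ap.
pose S1 := [set v in S | v \in p]; pose T1 := [set v in T | v \in p].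
have dis1 : [disjoint S1 & T1].
  by apply: disjointW dis; apply/subsetP=> v; rewrite inE => /andP[].
have sp : spath D S1 T1 p.
  split=> //; last first.
    move=> y; rewrite !inE -andb_orl; case yp: (y \in p); rewrite ?andbF ?andbT //.
    by have := al y yp; rewrite /= inE => ->.
  apply: (sub_in_sorted (P := mem p)) so; last exact/allP.
  by move=> a b /= ain bin; rewrite /bip !inE ain bin !andbT.
case E: p szp => [|x p'] szp; first by rewrite -szp in m2.
rewrite {1}E in sp; have : x \in S1 :|: T1 by case: sp => _ _ <-; rewrite inE eqxx.
rewrite inE => /orP[xS|xT]; first exact: (source_path_extend orD md dis1 sp xS szp).
rewrite -has_alt_conv.
apply: (source_path_extend (oriented_conv orD) (mindeg_conv md) _ (spath_conv sp) xT szp) => //.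
by rewrite disjoint_sym.
Qed.

Lemma consecutive_rel (e : rel V) p u v : sorted e p -> consecutive p u v -> e u v.
Proof.
rewrite /consecutive; case: p => //= x p; elim: p x => //= y p IH x /andP[xy pth].
by rewrite inE => /predU1P[[-> ->] //|]; apply: IH.
Qed.

Lemma apath_alternating D S T p : oriented D -> apath D S T p ->
  oriented_path D p /\ alternating D p.
Proof.
move=> [_ orD] /and4P[dis un /allP al so]; split.
  rewrite /oriented_path un /=; apply: sub_sorted so => u v.
  by case/orP=> /and3P[_ _ ->]; rewrite ?orbT.
have arc u v : path_arc D p u v -> D u v && bip D S T u v.
  case/andP=> -> /orP[] /(consecutive_rel so) //.
  by rewrite bip_sym.
move=> v vp; have := al v vp; rewrite /= inE => /orP[vS|vT]; [right|left] => u; apply/negP.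
  move=> /arc/andP[Duv]; rewrite bip_sym bip_l // => /andP[_ Dvu].
  by have := orD u v; rewrite Duv Dvu.
move=> /arc/andP[Dvu]; rewrite bip_r // => /andP[_ Duv].
by have := orD u v; rewrite Duv Dvu.
Qed.

Lemma mindeg_min_pseudo_semidegree D :
  0 < #|V| -> (forall v, ~~ isolated D v) -> mindeg D (min_pseudo_semidegree D).
Proof.
move=> V0 niso; have [_ _ lb] := min_pseudo_semidegreeP V0 niso.
move=> u v Duv; split.
  apply: lb; first by rewrite mem_cat orbC map_f ?mem_enum.
  by apply/card_gt0P; exists v; rewrite inE.
apply: lb; first by rewrite mem_cat (map_f (indeg D)) ?mem_enum.
by apply/card_gt0P; exists u; rewrite inE.
Qed.

Lemma has_alt1 D : 0 < #|V| -> has_alt D 1.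
Proof.
case/card_gt0P=> v _; apply: (@apath_has_alt _ D [set v] set0 [:: v]) => //.
by rewrite /apath /= disjoint_sym disjoints_subset sub0set !inE eqxx.
Qed.

Lemma has_alt2 D : oriented D -> 0 < #|V| -> (forall v, ~~ isolated D v) -> has_alt D 2.
Proof.
move=> [irr _] /card_gt0P[w _] niso.
have [u [v Duv]] : exists u v, D u v.
  have := niso w; rewrite negb_and -!lt0n => /orP[] /card_gt0P[u]; rewrite inE => h.
    by exists u, w.
  by exists w, u.
have uv : u != v by apply: contraTneq Duv => ->; rewrite irr.
apply: (@apath_has_alt _ D [set u] [set v] [:: u; v]) => //.
by rewrite /apath disjoints1 /= /bip !inE !eqxx Duv uv orbT.
Qed.

End Final.

Theorem theorem1p2 (k : nat) (V : finType) (D : rel V) :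
  (0 < k)%N ->
  oriented D ->
  (0 < #|V|)%N ->
  (forall v : V, ~~ isolated D v) ->
  (5%:R * k%:R / 8%:R < (min_pseudo_semidegree D)%:R :> rat)%R ->
  exists p : seq V, [/\ oriented_path D p, alternating D p & size p = k].
Proof.
move=> k0 orD V0 niso.
rewrite Num.Theory.ltr_pdivrMr ?Num.Theory.ltr0n // -!GRing.natrM Num.Theory.ltr_nat => hk.
have md := mindeg_min_pseudo_semidegree V0 niso.
have alt n : n.+1 <= k -> has_alt D n.+1.
  elim: n => [|[|n] IH] nk; [exact: has_alt1|exact: has_alt2|].
  apply: (has_alt_extend orD md) => //; last by apply: IH; apply: ltnW.
  by lia_nat.
have /has_altP[S [T [p [ap szp]]]] : has_alt D k by rewrite -(prednK k0) alt ?prednK.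
by have [op al] := apath_alternating orD ap; exists p.
Qed.
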